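(* Let $A\in\mathbb{R}^{n\times n}$ be nonsingular and let $k$ be a positive integer with $k<d(A)$. If $(\tilde{c},\tilde{v})\in\mathbb{R}^k\times S$ is a solution of the worst-case GMRES problem $$\max_{v\in S}\min_{c\in\mathbb{R}^{k}}f(c,v),$$ then $\tilde{v}$ is a right singular vector of the matrix $p(A;\tilde{c})$.
   Context: $\|\cdot\|$ is the Euclidean norm, $d(A)$ is the degree of the minimal polynomial of $A$, and $S=\{u\in\mathbb{R}^n:\|u\|=1\}$. For $c=[c_1,\dots,c_k]^T\in\mathbb{R}^k$ put $p(z;c)=1-\sum_{j=1}^k c_jz^j$, and for $v\in\mathbb{R}^n$ put $f(c,v)=\|p(A;c)v\|^2$. A point $(\tilde c,\tilde v)\in\mathbb{R}^k\times S$ is a solution of $\max_{v\in S}\min_{c\in\mathbb{R}^k}f(c,v)$ if $f(\tilde c,\tilde v)=\min_{c\in\mathbb{R}^k}f(c,\tilde v)=\max_{v\in S}\min_{c\in\mathbb{R}^k}f(c,v)$. A nonzero vector $v\in\mathbb{R}^n$ is a right singular vector of $M\in\mathbb{R}^{n\times n}$ if $M^TMv=\sigma^2v$ for some $\sigma\ge 0$. *)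

(* Defs.v *)
From mathcomp Require Import all_boot all_order all_algebra.
From mathcomp Require Import classical_sets reals.

Set Implicit Arguments.
Unset Strict Implicit.
Unset Printing Implicit Defensive.

Import Order.TTheory GRing.Theory Num.Theory.
Local Open Scope classical_set_scope.
Local Open Scope ring_scope.

Section WorstCaseGMRES.
Variable R : realType.

(* The library's norm on matrices is the sup norm, not the Euclidean one. *)
Definition enorm (n : nat) (v : 'cV[R]_n) : R :=
  Num.sqrt (\sum_i v i 0 ^+ 2).

Definition usphere (n : nat) : set 'cV[R]_n := [set u | enorm u = 1].

(* The coefficients are numbered from 0 here: the entry c j 0 is the
   coefficient c_(j+1), which goes with the power j + 1. *)
Definition gmres_poly (k : nat) (c : 'cV[R]_k) : {poly R} :=
  1 - \sum_(j < k) c j 0 *: 'X^(j.+1).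

Definition gmres_mx (n k : nat) (A : 'M[R]_n.+1) (c : 'cV[R]_k) : 'M[R]_n.+1 :=
  horner_mx A (gmres_poly c).

Definition gmres_obj (n k : nat) (A : 'M[R]_n.+1) (c : 'cV[R]_k)
    (v : 'cV[R]_n.+1) : R :=
  enorm (gmres_mx A c *m v) ^+ 2.

Definition is_min (E : set R) (m : R) : Prop := E m /\ lbound E m.

Definition is_max (E : set R) (m : R) : Prop := E m /\ ubound E m.

(* m = min_c f(c, v) *)
Definition is_inner_min (n k : nat) (A : 'M[R]_n.+1) (v : 'cV[R]_n.+1) (m : R)
    : Prop :=
  is_min [set gmres_obj A c v | c in [set: 'cV[R]_k]] m.

(* m = max_(v in S) min_c f(c, v) *)
Definition is_maxmin (n k : nat) (A : 'M[R]_n.+1) (m : R) : Prop :=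
  is_max [set t | exists2 v, usphere v & is_inner_min k A v t] m.

Definition worst_case_solution (n k : nat) (A : 'M[R]_n.+1)
    (c : 'cV[R]_k) (v : 'cV[R]_n.+1) : Prop :=
  [/\ usphere v, is_inner_min k A v (gmres_obj A c v)
    & is_maxmin k A (gmres_obj A c v)].

Definition right_singular_vector (n : nat) (M : 'M[R]_n) (v : 'cV[R]_n)
    : Prop :=
  v != 0 /\ exists2 s : R, 0 <= s & M^T *m M *m v = s ^+ 2 *: v.

End WorstCaseGMRES.

(* Main.v *)
Require Import Defs.
From mathcomp Require Import all_boot all_order all_algebra.
From mathcomp Require Import classical_sets reals.
From mathcomp Require Import ring.

(** Write K(w) for the Krylov matrix [A w, ..., A^k w], so that
    p(A; d) w = w - K(w) d, and put P = p(A; c), r = P v, g = |r|^2. The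
    function min_d f(d, w) is the squared distance from w to the column space of
    K(w), and v maximizes it on the sphere. By the envelope principle its
    gradient at v should be 2 P^T r, so that the Lagrange condition reads
    P^T P v = g v, which is the claim with singular value |r|.

    If g = 0 then P v = 0 and the claim is immediate. Otherwise K(v) is
    injective, because a dependence between A v, ..., A^k v could be divided by
    a power of the nonsingular A and would then express v itself through
    A v, ..., A^k v ([krylov_inj]).

    The differentiation is made algebraic by duality. Any y orthogonal to
    K(w) bounds the distance from below: for every d,
    (P w . y)^2 = (p(A; d) w . y)^2 <= f(d, w) |y|^2. Choosing d well,
    maximality and homogeneity give f(d, w) <= g |w|^2 ([worst_case_bound]),
    whence
        (P w . y)^2 <= g |w|^2 |y|^2.
    On the line w = v + t h one can take for y a vector that is polynomial in
    t and is a nonzero multiple of r at t = 0: Cramer's rule applied to the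
    projection of r off K(w) gives one ([cramer_residual]). The difference of
    the two sides is then a nonnegative polynomial in t that vanishes at 0, so
    its derivative vanishes there ([nonneg_poly_deriv0]). In that derivative
    the unknown y'(0) cancels, and what remains is r . P h = g (v . h) for all
    h, that is, P^T r = g v ([worst_case_stationary]). *)

Set Implicit Arguments.
Unset Strict Implicit.
Unset Printing Implicit Defensive.

Import Order.TTheory GRing.Theory Num.Theory.
Local Open Scope ring_scope.

(** * Inner products over a commutative ring *)

Section DotProduct.
Variable S : comNzRingType.

(** The scalars are a ring, so that the same product serves for vectors of
    polynomials. *)
Definition dot n (u v : 'cV[S]_n) : S := (u^T *m v) 0 0.

Lemma dotE n (u v : 'cV[S]_n) : dot u v = \sum_i u i 0 * v i 0.
Proof. by rewrite /dot mxE; apply: eq_bigr => i _; rewrite mxE. Qed.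

Lemma dotC n (u v : 'cV[S]_n) : dot u v = dot v u.
Proof. by rewrite !dotE; apply: eq_bigr => i _; rewrite mulrC. Qed.

Lemma dotDr n (u v w : 'cV[S]_n) : dot u (v + w) = dot u v + dot u w.
Proof. by rewrite /dot mulmxDr mxE. Qed.

Lemma dotDl n (u v w : 'cV[S]_n) : dot (v + w) u = dot v u + dot w u.
Proof. by rewrite dotC dotDr !(dotC u). Qed.

Lemma dotZr n a (u v : 'cV[S]_n) : dot u (a *: v) = a * dot u v.
Proof. by rewrite /dot -scalemxAr mxE. Qed.

Lemma dotZl n a (u v : 'cV[S]_n) : dot (a *: u) v = a * dot u v.
Proof. by rewrite dotC dotZr dotC. Qed.

Lemma dot0r n (u : 'cV[S]_n) : dot u 0 = 0.
Proof. by rewrite /dot mulmx0 mxE. Qed.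

Lemma dot_mulmxl m n (M : 'M[S]_(m, n)) u v :
  dot (M *m u) v = dot u (M^T *m v).
Proof. by rewrite /dot trmx_mul mulmxA. Qed.

Lemma dot_orthol m n (K : 'M[S]_(m, n)) c y :
  K^T *m y = 0 -> dot (K *m c) y = 0.
Proof. by move=> Ky; rewrite dot_mulmxl Ky dot0r. Qed.

End DotProduct.

Lemma map_dot (S T : comNzRingType) (f : {rmorphism S -> T}) n
    (u v : 'cV[S]_n) : f (dot u v) = dot (map_mx f u) (map_mx f v).
Proof.
by rewrite !dotE rmorph_sum; apply: eq_bigr => i _; rewrite rmorphM !mxE.
Qed.

Lemma deriv_dot (S : comNzRingType) n (u v : 'cV[{poly S}]_n) :
  (dot u v)^`() = dot (map_mx deriv u) v + dot u (map_mx deriv v).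
Proof.
rewrite !dotE raddf_sum -big_split /=; apply: eq_bigr => i _.
by rewrite derivM !mxE.
Qed.

(** * Least squares over an ordered field *)

Section RealDot.
Variable R : realFieldType.

Lemma dot_ge0 n (u : 'cV[R]_n) : 0 <= dot u u.
Proof. by rewrite dotE; apply: sumr_ge0 => i _; rewrite -expr2 sqr_ge0. Qed.

Lemma dot_eq0 n (u : 'cV[R]_n) : (dot u u == 0) = (u == 0).
Proof.
apply/idP/eqP => [|->]; last by rewrite dot0r.
rewrite dotE psumr_eq0 => [/allP u0|i _]; last by rewrite -expr2 sqr_ge0.
apply/matrixP => i j; rewrite (ord1 j) mxE.
by have := u0 i (mem_index_enum _); rewrite -expr2 expf_eq0 /= => /eqP.
Qed.

(** The gap between the two sides, times (v . v), is the squared norm of the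
    combination (v . v) u - (u . v) v. *)
Lemma dot_CauchySchwarz n (u v : 'cV[R]_n) :
  dot u v ^+ 2 <= dot u u * dot v v.
Proof.
have [->|v0] := eqVneq v 0; first by rewrite !dot0r expr0n mulr0.
have vv_gt0 : 0 < dot v v by rewrite lt_def dot_eq0 v0 dot_ge0.
have := dot_ge0 (dot v v *: u + (- dot u v) *: v).
rewrite !(dotDl, dotDr, dotZl, dotZr) (dotC v u).
move: (dot u u) (dot u v) (dot v v) vv_gt0 => a b g g_gt0.
rewrite [X in 0 <= X](_ : _ = g * (a * g - b ^+ 2)); last by ring.
by rewrite pmulr_rge0 // subr_ge0.
Qed.

(** Positivity of the inner product: K^T K x = 0 forces |K x|^2 = 0, column by
    column. *)
Lemma tr_mul_eq0 m n p (K : 'M[R]_(m, n)) (X : 'M[R]_(n, p)) :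
  K^T *m (K *m X) = 0 -> K *m X = 0.
Proof.
move=> KKX0; apply/matrixP => i j; rewrite [RHS]mxE.
have -> : (K *m X) i j = col j (K *m X) i 0 by rewrite [RHS]mxE.
suff /eqP -> : col j (K *m X) == 0 by rewrite mxE.
by rewrite -dot_eq0 colE -mulmxA dot_mulmxl !mulmxA -(mulmxA K^T) KKX0
   mul0mx dot0r.
Qed.

(** The row spaces of K and of K^T K coincide, since by [tr_mul_eq0] they have
    the same annihilator; hence least squares problems always have a solution,
    even when K is not of full rank. *)
Lemma normal_equations m n (K : 'M[R]_(m, n)) (w : 'cV[R]_m) :
  exists c, K^T *m (w - K *m c) = 0.
Proof.
have : (w^T *m K <= K^T *m K)%MS.
  rewrite submxE -mulmxA (@tr_mul_eq0 _ _ _ K) ?mulmx0 //.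
  by rewrite mulmxA mulmx_coker.
case/submxP => d wK; exists d^T.
apply: trmx_inj; rewrite mulmxBr linearB /= !trmx_mul !trmxK trmx0.
by rewrite -mulmxA -wK subrr.
Qed.

Lemma least_squares_pythagoras m n (K : 'M[R]_(m, n)) w c0 c :
  K^T *m (w - K *m c0) = 0 ->
  dot (w - K *m c) (w - K *m c) =
  dot (w - K *m c0) (w - K *m c0) + dot (K *m (c - c0)) (K *m (c - c0)).
Proof.
move=> ortho; have -> : w - K *m c = (w - K *m c0) + (- 1) *: (K *m (c - c0)).
  by rewrite mulmxBr scaleN1r opprB addrA subrK.
move: (w - K *m c0) ortho => r ortho.
rewrite !(dotDl, dotDr, dotZl, dotZr) (dotC r) dot_orthol //.
by ring.
Qed.

Lemma gram_unit m n (K : 'M[R]_(m, n)) :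
  (forall d : 'cV_n, K *m d = 0 -> d = 0) -> \det (K^T *m K) != 0.
Proof.
move=> inj; apply/negP => /det0P [u /negP u0 uG].
apply: u0; rewrite -(inj_eq (@trmx_inj _ _ _)) trmx0; apply/eqP/inj.
apply: tr_mul_eq0; rewrite mulmxA; apply: trmx_inj.
by rewrite trmx_mul trmxK trmx_mul trmxK uG trmx0.
Qed.

(** At a zero of a nonnegative polynomial the value is minimal. With
    F = (a + t G) t and |G| <= M near 0, a nonzero a would make F negative at a
    small t of the sign opposite to a. *)
Lemma nonneg_poly_deriv0 (F : {poly R}) :
  (forall t, 0 <= F.[t]) -> F.[0] = 0 -> F^`().[0] = 0.
Proof.
move=> F_ge0 /eqP/factor_theorem [Q FE].
have [G QE] : exists G, Q = Q.[0]%:P + G * 'X.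
  have /factor_theorem [G GE] : root (Q - Q.[0]%:P) 0.
    by rewrite rootE !hornerE subrr.
  by exists G; rewrite -['X]subr0 -GE addrC subrK.
have F0 : F^`().[0] = Q.[0] by rewrite FE subr0 !(derivE, hornerE).
rewrite F0; set a := Q.[0] in QE *.
have Ft t : 0 <= (a + G.[t] * t) * t.
  by have := F_ge0 t; rewrite FE subr0 QE !hornerE.
have [M GM] := poly_disk_bound G 1.
have M_ge0 : 0 <= M by apply: le_trans (GM 0 _); rewrite ?normr0.
apply/eqP/negP => /negP a0.
(* The term |a| keeps t inside the disk where M bounds G. *)
pose b := M + `|a| + 1; pose t := - a / b.
have b_gt0 : 0 < b by rewrite /b ltr_wpDl // addr_ge0.
have t1 : `|t| <= 1.
  rewrite normrM normrN normfV (gtr0_norm b_gt0) ler_pdivrMr // mul1r /b.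
  by rewrite -addrA (addrC `|a|) addrA lerDr addr_ge0.
have Gt : G.[t] < b.
  apply: le_lt_trans (le_trans (ler_norm _) (GM t t1)) _.
  by rewrite /b -addrA ltrDl ltr_wpDl.
have a2 : 0 < (a / b) ^+ 2.
  by rewrite exprn_even_gt0 //= mulf_neq0 ?invr_eq0 // gt_eqF.
have := Ft t; rewrite (_ : _ * t = (a / b) ^+ 2 * (G.[t] - b)).
  by rewrite pmulr_rge0 // subr_ge0 leNgt Gt.
by rewrite /t; field; rewrite gt_eqF.
Qed.

End RealDot.

(** * Polynomial curves of vectors *)

Section CramerResidual.
Variable S : comNzRingType.

(** The component of r orthogonal to the columns of K, multiplied by the Gram
    determinant: this clears the inverse of K^T K, so the formula makes sense over
    any commutative ring and yields polynomials when K and r have polynomial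
    entries. *)
Definition cramer_residual m n (K : 'M[S]_(m, n)) (r : 'cV[S]_m) : 'cV[S]_m :=
  \det (K^T *m K) *: r - K *m (\adj (K^T *m K) *m (K^T *m r)).

Lemma cramer_residual_orthol m n (K : 'M[S]_(m, n)) r :
  K^T *m cramer_residual K r = 0.
Proof.
rewrite /cramer_residual mulmxBr -scalemxAr mulmxA mulmxA mul_mx_adj.
by rewrite mul_scalar_mx subrr.
Qed.

Lemma cramer_residual_id m n (K : 'M[S]_(m, n)) r :
  K^T *m r = 0 -> cramer_residual K r = \det (K^T *m K) *: r.
Proof. by move=> Kr; rewrite /cramer_residual Kr !mulmx0 subr0. Qed.

Definition krylov n k (A : 'M[S]_n.+1) (v : 'cV[S]_n.+1) : 'M[S]_(n.+1, k) :=
  \matrix_(i, j) (A ^+ j.+1 *m v) i 0.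

End CramerResidual.

Lemma map_cramer_residual (S T : comNzRingType) (f : {rmorphism S -> T}) m n
    (K : 'M[S]_(m, n)) r :
  map_mx f (cramer_residual K r) =
  cramer_residual (map_mx f K) (map_mx f r).
Proof.
rewrite /cramer_residual map_mxB map_mxZ !map_mxM map_mx_adj -det_map_mx.
by rewrite !map_mxM !map_trmx.
Qed.

Lemma map_krylov (S T : comNzRingType) (f : {rmorphism S -> T}) n k
    (A : 'M[S]_n.+1) v :
  map_mx f (krylov k A v) = krylov k (map_mx f A) (map_mx f v).
Proof.
apply/matrixP => i j; rewrite [RHS]mxE [LHS]mxE [krylov k A v i j]mxE.
by rewrite -(rmorphXn (map_mx f)) -map_mxM [RHS]mxE.
Qed.

Section Line.
Variable S : comNzRingType.

Definition linev n (v h : 'cV[S]_n) : 'cV[{poly S}]_n :=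
  map_mx polyC v + 'X *: map_mx polyC h.

Lemma map_horner_polyC m n (M : 'M[S]_(m, n)) t :
  map_mx (horner_eval t) (map_mx polyC M) = M.
Proof. by apply/matrixP => i j; rewrite !mxE /horner_eval hornerC. Qed.

Lemma linev_horner n (v h : 'cV[S]_n) t :
  map_mx (horner_eval t) (linev v h) = v + t *: h.
Proof.
by rewrite map_mxD map_mxZ !map_horner_polyC /= /horner_eval hornerX.
Qed.

Lemma deriv_linev n (v h : 'cV[S]_n) :
  map_mx deriv (linev v h) = map_mx polyC h.
Proof.
by apply/matrixP => i j; rewrite !mxE !derivE mul1r mulr0 addr0 add0r.
Qed.

End Line.

(** * The worst-case GMRES problem *)

Section WorstCase.
Variables (R : realType) (n k : nat) (A : 'M[R]_n.+1).

Lemma enorm_sqr m (u : 'cV[R]_m) : enorm u ^+ 2 = dot u u.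
Proof.
rewrite sqr_sqrtr; last by apply: sumr_ge0 => i _; rewrite sqr_ge0.
by rewrite dotE; apply: eq_bigr => i _; rewrite expr2.
Qed.

Lemma gmres_mx_mul (c : 'cV[R]_k) v :
  gmres_mx A c *m v = v - krylov k A v *m c.
Proof.
rewrite /gmres_mx /gmres_poly rmorphB rmorph1 rmorph_sum /= mulmxBl mul1mx.
congr (_ - _); rewrite mulmx_suml; apply/matrixP => i j; rewrite (ord1 j).
rewrite summxE mxE; apply: eq_bigr => l _.
by rewrite linearZ /= rmorphXn /= horner_mx_X -scalemxAl !mxE mulrC.
Qed.

Lemma gmres_objE (c : 'cV[R]_k) v :
  gmres_obj A c v = dot (gmres_mx A c *m v) (gmres_mx A c *m v).
Proof. exact: enorm_sqr. Qed.

Lemma gmres_objZ (c : 'cV[R]_k) a v :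
  gmres_obj A c (a *: v) = a ^+ 2 * gmres_obj A c v.
Proof. by rewrite !gmres_objE -scalemxAr dotZl dotZr; ring. Qed.

Lemma inner_min_exists v : exists c : 'cV[R]_k,
  is_inner_min k A v (gmres_obj A c v).
Proof.
have [c ortho] := normal_equations (krylov k A v) v.
exists c; split; first by exists c.
move=> _ [d _ <-]; rewrite !gmres_objE !gmres_mx_mul.
by rewrite (least_squares_pythagoras d ortho) lerDl dot_ge0.
Qed.

(** The residuals at any two minimizers agree, so it suffices to compare with a
    solution of the normal equations. *)
Lemma inner_min_orthol (c : 'cV[R]_k) v :
  is_inner_min k A v (gmres_obj A c v) ->
  (krylov k A v)^T *m (gmres_mx A c *m v) = 0.
Proof.
move=> [_ cmin]; have [c0 ortho] := normal_equations (krylov k A v) v.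
have := cmin _ (ex_intro2 _ _ c0 I erefl).
rewrite !gmres_objE !gmres_mx_mul (least_squares_pythagoras c ortho).
rewrite gerDl => le0.
have : dot (krylov k A v *m (c - c0)) (krylov k A v *m (c - c0)) == 0.
  by rewrite eq_le le0 dot_ge0.
rewrite dot_eq0 mulmxBr subr_eq0 => /eqP ->.
exact: ortho.
Qed.

(** A relation d_1 A v + ... + d_k A^k v = 0 is s(A) v = 0 for a polynomial
    s = u X^m of degree at most k with u(0) <> 0. Since A is invertible,
    u(A) v = 0, and u / u(0) is an admissible residual polynomial that
    annihilates v. *)
Lemma krylov_inj v : A \in unitmx ->
  (forall c : 'cV[R]_k, gmres_mx A c *m v != 0) ->
  forall d : 'cV[R]_k, krylov k A v *m d = 0 -> d = 0.
Proof.
move=> Au nz d Kd.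
pose s : {poly R} := 1 - gmres_poly d.
have sE : s = \sum_(j < k) d j 0 *: 'X^(j.+1).
  by rewrite /s /gmres_poly opprB addrCA subrr addr0.
have scoef (j : 'I_k) : s`_j.+1 = d j 0.
  rewrite sE coef_sum (bigD1 j) //= coefZ coefXn eqxx mulr1 big1 ?addr0 //.
  move=> i ij; rewrite coefZ coefXn eqSS (inj_eq val_inj) eq_sym (negPf ij).
  by rewrite mulr0.
have ssize : (size s <= k.+1)%N.
  rewrite sE; apply: leq_trans (size_sum _ _ _) _; apply/bigmax_leqP => i _.
  by apply: leq_trans (size_scale_leq _ _) _; rewrite size_polyXn ltnS.
have sv : horner_mx A s *m v = 0.
  rewrite /s rmorphB rmorph1 mulmxBl mul1mx [X in _ - X](gmres_mx_mul d v).
  by rewrite Kd subr0 subrr.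
have [s0|s0] := eqVneq s 0.
  by apply/matrixP => i j; rewrite (ord1 j) mxE -scoef s0 coef0.
have [m [u /implyP/(_ s0) u0 su]] := multiplicity_XsubC s 0.
rewrite subr0 in su.
have uv : horner_mx A u *m v = 0.
  have : A ^+ m *m (horner_mx A u *m v) = 0.
    rewrite mulmxA -sv su mulrC rmorphM rmorphXn /= horner_mx_X.
    by [].
  move/(congr1 (mulmx (invmx (A ^+ m)))).
  by rewrite mulmx0 mulKmx //; apply: (unitrX m Au).
have usize : (size u <= k.+1)%N.
  apply: leq_trans ssize; rewrite su size_Mmonic ?monicXn //; last first.
    by apply: contraNneq s0 => u_0; rewrite su u_0 mul0r.
  by rewrite size_polyXn addnS /= leq_addr.
pose e : 'cV[R]_k := \col_j (- u`_j.+1 / u`_0).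
have u00 : u`_0 != 0 by rewrite -horner_coef0 -rootE.
have eE : gmres_poly e = (u`_0)^-1 *: u.
  apply/polyP => i; rewrite /gmres_poly coefB coefZ coef1 coef_sum.
  case: i => [|i].
    rewrite big1 ?subr0 ?mulVf // => j _.
    by rewrite coefZ coefXn mulr0.
  rewrite sub0r; have [ik|ki] := ltnP i k.
    rewrite (bigD1 (Ordinal ik)) //= big1 => [|j ji].
      by rewrite coefZ coefXn eqxx mxE /=; ring.
    rewrite coefZ coefXn eqSS eq_sym -(inj_eq val_inj) /= in ji *.
    by rewrite (negPf ji) mulr0.
  rewrite big1 => [|j _].
    by rewrite oppr0 [X in _ * X]nth_default ?mulr0 // (leq_trans usize).
  rewrite coefZ coefXn eqSS gtn_eqF ?mulr0 //.
  exact: leq_trans (ltn_ord j) ki.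
have := nz e; rewrite /gmres_mx eE linearZ /= -scalemxAl uv scaler0.
by rewrite eqxx.
Qed.

Variables (c : 'cV[R]_k) (v : 'cV[R]_n.+1).
Hypothesis cv : worst_case_solution A c v.

(** Both sides are homogeneous of degree two in w, which transfers the
    maximality of v on the sphere to all vectors. *)
Lemma worst_case_bound w :
  exists d : 'cV[R]_k, gmres_obj A d w <= gmres_obj A c v * dot w w.
Proof.
have [_ _ [_ maxv]] := cv.
have [->|w0] := eqVneq w 0.
  by exists 0; rewrite gmres_objE mulmx0 !dot0r mulr0.
have ww_gt0 : 0 < dot w w by rewrite lt_def dot_eq0 w0 dot_ge0.
have [d dmin] := inner_min_exists ((enorm w)^-1 *: w); exists d.
have : gmres_obj A d ((enorm w)^-1 *: w) <= gmres_obj A c v.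
  apply: maxv; exists ((enorm w)^-1 *: w) => //.
  rewrite /usphere /=; apply/eqP.
  rewrite -(@eqrXn2 _ 2) ?sqrtr_ge0 // enorm_sqr dotZl dotZr mulrA -expr2.
  by rewrite exprVn enorm_sqr mulVf ?expr1n // gt_eqF.
rewrite gmres_objZ exprVn enorm_sqr mulrC ler_pdivrMr //.
Qed.

(** The Lagrange condition, in weak form. *)
Lemma worst_case_stationary : A \in unitmx -> gmres_obj A c v != 0 ->
  forall h, dot (gmres_mx A c *m v) (gmres_mx A c *m h) =
            gmres_obj A c v * dot v h.
Proof.
move=> Au; set g := gmres_obj A c v; set P := gmres_mx A c; set r := P *m v.
move=> g0 h.
have [vS cmin _] := cv.
have rr : dot r r = g by rewrite /g gmres_objE.
have vv : dot v v = 1 by rewrite -enorm_sqr vS expr1n.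
have Kr := inner_min_orthol cmin.
(* Q is the path p(A; c) W, written with its two coefficients. *)
pose W := linev v h; pose Q := linev r (P *m h).
pose Y := cramer_residual (krylov k (map_mx polyC A) W) (map_mx polyC r).
have Yt t : map_mx (horner_eval t) Y =
    cramer_residual (krylov k A (v + t *: h)) r.
  by rewrite map_cramer_residual map_krylov linev_horner !map_horner_polyC.
pose F := g%:P * dot Y Y * dot W W - dot Q Y ^+ 2.
have F_ge0 t : 0 <= F.[t].
  rewrite !hornerE -!/(horner_eval t _) !map_dot !linev_horner Yt.
  set w := v + t *: h; set y := cramer_residual _ _.
  have -> : r + t *: (P *m h) = P *m w by rewrite /w mulmxDr -scalemxAr.
  (* The residuals of w for all d differ by vectors of the column space of
     K(w), hence have the same product with y. *)
  have resy (d : 'cV[R]_k) : dot (gmres_mx A d *m w) y = dot w y.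
    rewrite gmres_mx_mul -scaleN1r dotDl dotZl dot_orthol ?mulr0 ?addr0 //.
    exact: cramer_residual_orthol.
  have [d dw] := worst_case_bound w.
  rewrite subr_ge0 resy -(resy d).
  apply: le_trans (dot_CauchySchwarz _ _) _.
  rewrite -gmres_objE mulrC (mulrC g) -mulrA.
  by apply: ler_wpM2l dw; apply: dot_ge0.
set K := krylov k A v in Kr.
have Y0 : map_mx (horner_eval 0) Y = \det (K^T *m K) *: r.
  by rewrite Yt scale0r addr0 cramer_residual_id.
have detK : \det (K^T *m K) != 0.
  apply/gram_unit/krylov_inj => // d.
  apply: contraNneq g0 => Pd; rewrite eq_le; apply/andP; split; last first.
    by rewrite /g gmres_objE dot_ge0.
  have -> : 0 = gmres_obj A d v by rewrite gmres_objE Pd dot0r.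
  by apply: (cmin.2); exists d.
have F0 : F.[0] = 0.
  rewrite !hornerE -!/(horner_eval 0 _) !map_dot !linev_horner Y0.
  by rewrite !scale0r !addr0 !(dotZl, dotZr) rr vv; ring.
(* At 0 the derivative of Y enters only through its product y . r, which
   occurs with opposite signs in the two terms of F. *)
have := nonneg_poly_deriv0 F_ge0 F0.
rewrite !(derivE, deriv_dot) /= !hornerE -!/(horner_eval 0 _) !map_dot.
rewrite !deriv_linev !linev_horner !map_horner_polyC Y0 !scale0r !addr0.
set y := map_mx _ (map_mx deriv Y).
rewrite !(dotZl, dotZr) rr vv (dotC y) (dotC h) (dotC (P *m h)).
move: detK; set D := \det _; set x := dot r _; set z := dot v h.
move=> D0 F'0; have : (2 * g * D ^+ 2) * (g * z - x) = 0.
  by rewrite -F'0; ring.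
have k0 : 2 * g * D ^+ 2 != 0.
  by apply: mulf_neq0; [apply: mulf_neq0; rewrite ?pnatr_eq0 | apply: expf_neq0].
by move/eqP; rewrite mulf_eq0 (negPf k0) subr_eq0 => /eqP.
Qed.

End WorstCase.

Theorem theorem3p5 (R : realType) (n k : nat) (A : 'M[R]_n.+1)
    (c : 'cV[R]_k) (v : 'cV[R]_n.+1) :
  A \in unitmx ->
  (0 < k)%N -> (k < degree_mxminpoly A)%N ->
  worst_case_solution A c v ->
  right_singular_vector (gmres_mx A c) v.
Proof.
move=> Au _ _ cv; have [vS _ _] := cv; split.
  apply: contra_eq_neq vS => ->.
  rewrite /usphere /= -(@eqrXn2 _ 2) ?sqrtr_ge0 // enorm_sqr dot0r expr1n.
  by rewrite eq_sym oner_neq0.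
exists (enorm (gmres_mx A c *m v)); first exact: sqrtr_ge0.
rewrite -/(gmres_obj A c v).
have [g0|g0] := eqVneq (gmres_obj A c v) 0.
  have Mv : gmres_mx A c *m v = 0.
    by apply/eqP; rewrite -dot_eq0 -gmres_objE g0.
  by rewrite -mulmxA Mv mulmx0 g0 scale0r.
apply/matrixP => i j; rewrite (ord1 j).
have := worst_case_stationary cv Au g0 (delta_mx i 0).
rewrite dotC dot_mulmxl mulmxA (dotC v).
have dot_delta u : dot (delta_mx i 0) u = u i 0.
  by rewrite /dot trmx_delta -rowE mxE.
by rewrite !dot_delta => ->; rewrite mxE.
Qed.
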